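(* Let $\mu$ be a symmetric probability measure on $\mathbb{R}$ such that $m_1(\mu)=0$, $m_2(\mu)=1$ and $m_4(\mu)<+\infty$. For $n\ge1$ let $\mu_n$ be the dilation of $\mu^{\uplus n}$ by $\frac1{\sqrt n}$, i.e. $\mu_n(A)=\mu^{\uplus n}\left(\{x:\frac1{\sqrt n}x\in A\}\right)$ for Borel sets $A$. Then for all $n\ge1$, $$W_2(\mu_n,\mathrm{b})\le D^*(\mu_n|\mathrm{b})=\frac1{\sqrt n}\sqrt{m_4(\mu)-1}.$$
   Context: $\mathrm{b}=\frac12\delta_{-1}+\frac12\delta_{1}$ is the Rademacher distribution; $m_k(\mu)=\int x^k\,d\mu(x)$; $W_2(\mu,\nu)=\inf_\pi\left(\iint|x-y|^2\,d\pi(x,y)\right)^{1/2}$, the infimum being over all couplings of $(\mu,\nu)$. The Boolean Stein discrepancy is $D^*(\mu|\mathrm{b})=\left(\int(x^2-1)^2\,d\mu(x)\right)^{1/2}\in[0,+\infty]$. For a probability measure $\mu$ on $\mathbb{R}$ and $z$ in the upper half-plane, let $G_\mu(z)=\int\frac{1}{z-x}\,d\mu(x)$ and $K_\mu(z)=z-1/G_\mu(z)$. The Boolean convolution $\mu\uplus\nu$ of two probability measures on $\mathbb{R}$ is the unique probability measure with $K_{\mu\uplus\nu}(z)=K_\mu(z)+K_\nu(z)$ for all $z$ with $\Im z>0$; $\mu^{\uplus n}$ is the $n$-fold Boolean convolution of $\mu$ with itself. *)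

(* Defs.v *)
From HB Require Import structures.
From mathcomp Require Import all_boot all_order all_algebra.
From mathcomp Require Import all_classical all_reals all_analysis.
From mathcomp Require Import measurable_realfun.
From mathcomp.real_closed Require Import complex.

Set Implicit Arguments.
Unset Strict Implicit.
Unset Printing Implicit Defensive.

Import Order.TTheory GRing.Theory Num.Theory.

Local Open Scope classical_set_scope.
Local Open Scope ring_scope.

Notation probR R := (probability (measurableTypeR R) R).

Section transforms.
Context {R : realType}.
Implicit Types (mu nu rho : probR R) (z : R[i]).
Local Open Scope complex_scope.

(* The integral of a complex-valued function is taken componentwise.  The
   integrand below is bounded when 0 < Im z, so both components converge. *)
Definition cauchy_transform mu z : R[i] :=
  (\int[mu]_x complex.Re ((z - x%:C)^-1)) +i*
  (\int[mu]_x complex.Im ((z - x%:C)^-1)).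

Definition K_transform mu z : R[i] := z - (cauchy_transform mu z)^-1.

Definition is_boolean_conv mu nu rho : Prop :=
  forall z, 0 < complex.Im z ->
    K_transform rho z = K_transform mu z + K_transform nu z.

(* Boolean convolution is only defined through its K-transform, hence as a
   relation; [is_boolean_pow mu n rho] says that rho is the n-fold Boolean
   convolution of mu with itself.  There is no case n = 0. *)
Inductive is_boolean_pow mu : nat -> probR R -> Prop :=
| is_boolean_pow1 : is_boolean_pow mu 1 mu
| is_boolean_powS n nu rho :
    is_boolean_pow mu n nu -> is_boolean_conv nu mu rho ->
    is_boolean_pow mu n.+1 rho.

End transforms.

Section measures.
Context {R : realType}.

Definition symmetric_prob (mu : probR R) : Prop :=
  forall A : set (measurableTypeR R), measurable A ->
    mu (-%R @^-1` A) = mu A.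

Definition scale_fun (c : R) : measurableTypeR R -> measurableTypeR R :=
  fun x => c * x.

Lemma measurable_scale_fun (c : R) : measurable_fun setT (scale_fun c).
Proof. exact: mulrl_measurable. Qed.

HB.instance Definition _ (c : R) :=
  isMeasurableFun.Build _ _ _ _ (scale_fun c) (measurable_scale_fun c).

(* [dilation c mu A = mu [set x | A (c * x)]], by unfolding. *)
Definition dilation (c : R) (mu : probR R) : probR R :=
  distribution mu (scale_fun c).

Definition rademacher : set (measurableTypeR R) -> \bar R :=
  measure_add (mscale (2^-1)%:nng \d_(-1 : measurableTypeR R))
              (mscale (2^-1)%:nng \d_(1 : measurableTypeR R)).

HB.instance Definition _ := Measure.on rademacher.

Let rademacher_setT : rademacher setT = 1%E.
Proof.
rewrite /rademacher measure_addE /= /mscale /= !diracT !mule1 -EFinD.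
by rewrite -[2^-1]mul1r -splitr.
Qed.

HB.instance Definition _ :=
  @Measure_isProbability.Build _ _ R rademacher rademacher_setT.

End measures.

Section moments_and_distances.
Context {R : realType}.
Implicit Types mu nu : probR R.
Local Open Scope ereal_scope.

Definition moment (k : nat) mu : \bar R := \int[mu]_x (x ^+ k)%:E.

Definition couplings mu nu :
    set (probability (measurableTypeR R * measurableTypeR R)%type R) :=
  [set pi | (forall A, measurable A -> pi (fst @^-1` A) = mu A) /\
            (forall B, measurable B -> pi (snd @^-1` B) = nu B)].

Definition W2 mu nu : \bar R :=
  ereal_inf [set sqrte (\int[pi]_p (`|p.1 - p.2| ^+ 2)%:E)
            | pi in couplings mu nu].

Definition boolean_stein_discrepancy mu : \bar R :=
  sqrte (\int[mu]_x ((x ^+ 2 - 1) ^+ 2)%:E).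

End moments_and_distances.

(* Main.v *)
Require Import Defs.
From HB Require Import structures.
From mathcomp Require Import all_boot all_order all_algebra.
From mathcomp Require Import all_classical all_reals all_analysis.
From mathcomp Require Import measurable_realfun ring lra.
From mathcomp.real_closed Require Import complex.

(* On the imaginary axis G(iy) = - int x / (x^2 + y^2) - i h(y) / y with
   h(y) = int y^2 / (x^2 + y^2).  Symmetry of mu makes K_mu(iy) imaginary,
   hence K_rho(iy) = n K_mu(iy) too, where rho is the n-fold Boolean power, so
   that Re G_rho(iy) = 0 and 1 / h_rho - 1 = n (1 / h_mu - 1).
   - Moments: y^2 (1 - h(y)) = int x^2 y^2 / (x^2 + y^2) increases to m_2 and
     y^2 (m_2 - y^2 (1 - h(y))) = int x^4 y^2 / (x^2 + y^2) increases to m_4 as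
     y -> +oo, so the relation between h_rho and h_mu gives m_2(rho) = n and
     m_4(rho) = n (m_4(mu) + n - 1).
   - Wasserstein bound: as int_0^oo x / (x^2 + y^2) dy = (pi / 2) sgn x,
     integrating Re G_rho(iy) = 0 over y > 0 shows that rho gives the same mass
     to both open half-lines; this avoids Stieltjes inversion.  Hence a sign of
     x, randomized at x = 0, is Rademacher, and
     |x - sgn x| = ||x| - 1| <= |x^2 - 1| under this coupling. *)

Set Implicit Arguments.
Unset Strict Implicit.
Unset Printing Implicit Defensive.

Import Order.TTheory GRing.Theory Num.Theory.
Import numFieldNormedType.Exports.

Local Open Scope classical_set_scope.
Local Open Scope ring_scope.

(** * The cutoff [damping] and its monotone limit *)

Section damping.
Context {R : realType}.
Implicit Types (nu : probR R) (y : R).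

(** For y > 0 this is - y Im (1 / (iy - x)), the Poisson kernel scaled to the value 1 at x = 0. It
    acts as a cutoff that increases to 1 with y. *)
Definition damping y (x : R) : R := y ^+ 2 / (x ^+ 2 + y ^+ 2).

Lemma sum_sqr_gt0 (x y : R) : 0 < y -> 0 < x ^+ 2 + y ^+ 2.
Proof. by move=> y0; rewrite ltr_wpDl ?sqr_ge0// exprn_gt0. Qed.

Lemma measurable_sum_sqrV d (T : measurableType d) (f g : T -> R) :
  measurable_fun setT f -> measurable_fun setT g ->
  measurable_fun setT (fun t => (f t ^+ 2 + g t ^+ 2)^-1).
Proof.
move=> mf mg.
(* [powR] is known to be measurable, [^-1] is not. *)
under eq_fun do rewrite -powR_inv1 ?addr_ge0 ?sqr_ge0//.
apply: (measurableT_comp (measurable_powR _)).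
by apply: measurable_funD; exact: measurable_funX.
Qed.

Lemma damping_ge0 y x : 0 <= damping y x.
Proof. by rewrite divr_ge0 ?addr_ge0 ?sqr_ge0. Qed.

Lemma damping_le1 y x : 0 < y -> damping y x <= 1.
Proof.
by move=> y0; rewrite ler_pdivrMr ?sum_sqr_gt0// mul1r lerDr sqr_ge0.
Qed.

Lemma damping_gt0 y x : 0 < y -> 0 < damping y x.
Proof. by move=> y0; rewrite divr_gt0 ?sum_sqr_gt0// exprn_gt0. Qed.

Lemma damping_homo x : {in Num.pos &, {homo damping^~ x : y y' / y <= y'}}.
Proof.
move=> y y'; rewrite !posrE => y0 y'0 yy'.
rewrite /damping ler_pdivrMr ?sum_sqr_gt0// mulrAC ler_pdivlMr ?sum_sqr_gt0//.
rewrite !mulrDr [y' ^+ 2 * y ^+ 2]mulrC lerD2r.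
by rewrite ler_wpM2r ?sqr_ge0// ler_sqr ?nnegrE//; exact: ltW.
Qed.

Lemma measurable_damping y : measurable_fun setT (damping y).
Proof. by apply: measurable_funM => //; exact: measurable_sum_sqrV. Qed.

(** Reduces truncated moments of order 2 and 4 to [damped_mass]: each use trades x^2 for y^2 times
    the defect of the cutoff. *)
Lemma sqr_mul_damping y x : 0 < y ->
  x ^+ 2 * damping y x = y ^+ 2 * (1 - damping y x).
Proof.
move=> y0; rewrite /damping.
field.
by rewrite gt_eqF ?sum_sqr_gt0.
Qed.

Lemma cvg_damping x : damping n.+1%:R x @[n --> \oo] --> (1 : R).
Proof.
(* With y = n + 1, the defect x^2 / (x^2 + y^2) is split as x^2 / y times [damping y x / y]. Since y
   >= 1 the last factor lies in [0, 1], and a squeeze by x^2 / y concludes. *)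
have -> : (fun n => damping n.+1%:R x) =
    (fun n => 1 - x ^+ 2 * (n.+1%:R^-1) * (damping n.+1%:R x / n.+1%:R)).
  apply/funext => n; have : 0 < n.+1%:R :> R by [].
  move: (n.+1%:R) => y y0; rewrite /damping; field.
  by rewrite !gt_eqF ?sum_sqr_gt0.
rewrite -[X in _ --> X]subr0.
apply: cvgB; first exact: cvg_cst.
apply: (@squeeze_cvgr _ _ _ _ (cst 0) (fun n => x ^+ 2 * n.+1%:R^-1)).
- near=> n; rewrite /= mulr_ge0 ?divr_ge0 ?damping_ge0 ?addr_ge0 ?sqr_ge0//=.
  rewrite ler_piMr ?divr_ge0 ?sqr_ge0// ler_pdivrMr// mul1r.
  by rewrite (le_trans (damping_le1 _ _))// ler1n.
- exact: cvg_cst.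
- rewrite -[X in _ --> X](mulr0 (x ^+ 2)).
  by apply: cvgM; [exact: cvg_cst|exact: cvg_harmonic].
Unshelve. all: end_near. Qed.

Lemma complex_inv_re_im (a b : R) :
  (Complex a b)^-1 =
  Complex (a / (a ^+ 2 + b ^+ 2)) (- (b / (a ^+ 2 + b ^+ 2))).
Proof. by []. Qed.

(** Monotone convergence along y = n + 1. The limit lives in the extended reals and may be +oo, so
    that finiteness of the moments of the Boolean power comes out of the limit. *)
Lemma monotone_damping nu (f : R -> R) : measurable_fun setT f ->
  (forall x, 0 <= f x) ->
  (\int[nu]_x (f x * damping n.+1%:R x)%:E @[n --> \oo] -->
   \int[nu]_x (f x)%:E)%E.
Proof.
move=> mf f0.
have cf x : (f x * damping n.+1%:R x)%:E @[n --> \oo] --> (f x)%:E.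
  apply: cvg_EFin; first exact: nearW.
  rewrite -[X in _ --> X]mulr1.
  by apply: cvgM; [exact: cvg_cst|exact: cvg_damping].
under [X in _ --> X]eq_integral do
  rewrite -(cvg_lim (@ereal_hausdorff _) (cf _)).
apply: cvg_monotone_convergence => //.
- move=> n; apply/measurable_EFinP; apply: measurable_funM => //.
  exact: measurable_damping.
- by move=> n x _; rewrite lee_fin mulr_ge0 ?damping_ge0.
- move=> x _ m n mn; rewrite lee_fin ler_wpM2l// damping_homo ?posrE//.
  by rewrite ler_nat.
Qed.

End damping.

(** * Cauchy and K-transforms on the imaginary axis *)

Section imaginary_axis.
Context {R : realType}.
Implicit Types (mu nu rho : probR R) (y : R).
Local Open Scope complex_scope.

Lemma integrable_bounded nu (f : R -> R) (M : R) : measurable_fun setT f ->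
  (forall x, `|f x| <= M) -> nu.-integrable setT (EFin \o f).
Proof.
move=> mf fM; apply: (@le_integrable _ _ _ nu setT measurableT _ (cst M%:E)).
- exact/measurable_EFinP.
- by move=> x _; rewrite /= lee_fin (le_trans (fM x))// ler_norm.
- exact: finite_measure_integrable_cst.
Qed.

Lemma integrable_damping nu y : 0 < y ->
  nu.-integrable setT (EFin \o damping y).
Proof.
move=> y0; apply: (@integrable_bounded _ _ 1); first exact: measurable_damping.
by move=> x; rewrite ger0_norm ?damping_ge0// damping_le1.
Qed.

(* [h] of the header. *)
Definition damped_mass nu y : R := \int[nu]_x damping y x.

(** For y > 0 this is - Re G(iy), an integral against the conjugate Poisson kernel up to the factor
    pi. *)
Definition conj_poisson nu y : R := \int[nu]_x (x / (x ^+ 2 + y ^+ 2)).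

Lemma measurable_conj_kernel y :
  measurable_fun setT (fun x : R => x / (x ^+ 2 + y ^+ 2)).
Proof. by apply: measurable_funM => //; exact: measurable_sum_sqrV. Qed.

Lemma conj_kernel_le y x : 0 < y -> `|x / (x ^+ 2 + y ^+ 2)| <= y^-1.
Proof.
move=> y0; rewrite normrM (ger0_norm (_ : 0 <= (_ + _)^-1)); last first.
  by rewrite invr_ge0 ltW// sum_sqr_gt0.
rewrite ler_pdivrMr ?sum_sqr_gt0// mulrC ler_pdivlMr//.
rewrite -(real_normK (num_real x)).
(* With weights 3/4 and 1/4 these squares add up to x^2 + y^2 - |x| y. *)
by have := sqr_ge0 (`|x| - y); have := sqr_ge0 (`|x| + y); nra.
Qed.

Lemma integrable_conj_kernel nu y : 0 < y ->
  nu.-integrable setT (EFin \o (fun x : R => x / (x ^+ 2 + y ^+ 2))).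
Proof.
move=> y0; apply: (@integrable_bounded _ _ y^-1).
  exact: measurable_conj_kernel.
by move=> x; exact: conj_kernel_le.
Qed.

Lemma cauchy_transform_imag nu y : 0 < y ->
  cauchy_transform nu (0 +i* y) =
  (- conj_poisson nu y) +i* (- (damped_mass nu y / y)).
Proof.
move=> y0; rewrite /cauchy_transform /conj_poisson /damped_mass.
rewrite -mulN1r -RintegralZl//; last exact: integrable_conj_kernel.
rewrite -[in RHS]mulrN -RintegralZr//; last exact: integrable_damping.
congr (_ +i* _); apply: eq_Rintegral => x _ /=.
  by rewrite sub0r sqrrN subr0 mulN1r mulNr.
by rewrite sub0r sqrrN subr0 /damping; field; rewrite !gt_eqF// sum_sqr_gt0.
Qed.

Lemma damped_massE nu y : 0 < y ->
  (\int[nu]_x (damping y x)%:E)%E = (damped_mass nu y)%:E.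
Proof.
move=> y0; rewrite /damped_mass /Rintegral fineK//.
by apply: integrable_fin_num => //; exact: integrable_damping.
Qed.

(** An everywhere positive function with zero integral would vanish almost everywhere, making the
    whole line a null set. Positivity ensures that G(iy) is nonzero. *)
Lemma damped_mass_gt0 nu y : 0 < y -> 0 < damped_mass nu y.
Proof.
move=> y0; rewrite lt_neqAle Rintegral_ge0 ?andbT; last first.
  by move=> x _; exact: damping_ge0.
apply/eqP => /esym h0.
have : (\int[nu]_x `|(damping y x)%:E| = 0)%E.
  under eq_integral do rewrite /= ger0_norm ?damping_ge0//.
  by rewrite damped_massE// h0.
move/(ae_eq_integral_abs nu measurableT).
case=> [|N [mN N0 subN]].
  by apply/measurable_EFinP; exact: measurable_damping.
have : nu setT = 0%E.
  apply/eqP; rewrite eq_le measure_ge0 andbT -N0 le_measure ?inE//.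
  move=> x _; apply: subN => /(_ I)[] /eqP.
  by rewrite gt_eqF// damping_gt0.
by rewrite probability_setT => /eqP; rewrite onee_eq0.
Qed.

Lemma K_transform_imag nu y : 0 < y -> conj_poisson nu y = 0 ->
  K_transform nu (0 +i* y) = 0 +i* (- (y * ((damped_mass nu y)^-1 - 1))).
Proof.
move=> y0 h0; rewrite /K_transform cauchy_transform_imag// h0 oppr0.
rewrite complex_inv_re_im; simpc; congr (_ +i* _).
field.
by rewrite !gt_eqF// damped_mass_gt0.
Qed.

Lemma K_transform_pow mu n rho z : is_boolean_pow mu n rho ->
  0 < complex.Im z -> K_transform rho z = n%:R * K_transform mu z.
Proof.
move=> + z0; elim=> [|m nu' rho' _ IH conv]; first by rewrite mul1r.
by rewrite conv// IH -[in RHS]natr1 mulrDl mul1r.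
Qed.

(** The kernel is odd and [mu] is its own image under negation, so the integral equals its
    opposite. *)
Lemma conj_poisson_symmetric mu y : 0 < y -> symmetric_prob mu ->
  conj_poisson mu y = 0.
Proof.
move=> y0 sym; set f := fun x : R => x / (x ^+ 2 + y ^+ 2).
have mN : measurable_fun setT (-%R : measurableTypeR R -> measurableTypeR R).
  exact: oppr_measurable.
pose N : {mfun measurableTypeR R >-> measurableTypeR R} :=
  HB.pack (-%R : measurableTypeR R -> measurableTypeR R)
    (isMeasurableFun.Build _ _ _ _ _ mN).
have intf := integrable_conj_kernel mu y0.
have : conj_poisson mu y = - conj_poisson mu y.
  rewrite -[RHS]mulN1r -RintegralZl// /conj_poisson /Rintegral; congr fine.
  transitivity (\int[distribution mu N]_x (f x)%:E)%E.
    by apply: eq_measure_integral => A mA _; rewrite -[LHS]sym.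
  rewrite integral_distribution//.
  - by apply: eq_integral => x _ /=; rewrite /f sqrrN mulNr mulN1r.
  - by apply/measurable_EFinP; exact: measurable_conj_kernel.
  - apply: (@integrable_bounded _ (f \o N) y^-1) => [|x].
      by apply: measurableT_comp => //; exact: measurable_conj_kernel.
    exact: conj_kernel_le.
lra.
Qed.

Lemma K_transform_pow_imag mu n rho y : symmetric_prob mu ->
  is_boolean_pow mu n rho -> 0 < y ->
  conj_poisson rho y = 0 /\
  (damped_mass rho y)^-1 - 1 = n%:R * ((damped_mass mu y)^-1 - 1).
Proof.
move=> sym pow y0.
have mu0 := conj_poisson_symmetric y0 sym.
have := K_transform_pow (z := 0 +i* y) pow y0.
rewrite (K_transform_imag y0 mu0) -[n%:R](rmorph_nat (real_complex R)).
rewrite [X in _ = X](_ : _ =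
  0 +i* (- (n%:R * (y * ((damped_mass mu y)^-1 - 1))))); last first.
  by rewrite /real_complex_def; simpc.
move=> Krho.
(* Re G_rho is not known beforehand, so it is read off from G_rho = 1 / (z - K_rho): z - K_rho is
   purely imaginary, hence so is its inverse. *)
have rho0 : conj_poisson rho y = 0.
  have G : (cauchy_transform rho (0 +i* y))^-1 =
     0 +i* (y + n%:R * (y * ((damped_mass mu y)^-1 - 1))).
    transitivity (0 +i* y - K_transform rho (0 +i* y)).
      by rewrite /K_transform opprB addrC subrK.
    by rewrite Krho; simpc.
  move: (congr1 GRing.inv G); rewrite invrK cauchy_transform_imag//.
  rewrite complex_inv_re_im mul0r => -[/eqP].
  by rewrite oppr_eq0 => /eqP.
split=> //; move: Krho; rewrite K_transform_imag// => -[/oppr_inj].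
rewrite mulrCA; exact/mulfI/lt0r_neq0.
Qed.

End imaginary_axis.

(** * Second and fourth moments of the Boolean power *)

Section moments.
Context {R : realType}.
Implicit Types (mu nu rho : probR R) (y : R).

(** By [sqr_mul_damping] this is, for y > 0, the second moment truncated by the cutoff, a real
    number for every [nu]. Written through [damped_mass], it can be fed with the relation between
    K-transforms. *)
Definition damped_moment2 nu y : R := y ^+ 2 * (1 - damped_mass nu y).

Lemma integral_sqr_damping nu y : 0 < y ->
  (\int[nu]_x (x ^+ 2 * damping y x)%:E)%E = (damped_moment2 nu y)%:E.
Proof.
move=> y0; under eq_integral do rewrite sqr_mul_damping// EFinM EFinB.
have int1 : nu.-integrable setT (cst (1 : R)%:E).
  exact: finite_measure_integrable_cst.
have intd := integrable_damping nu y0.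
rewrite integralZl//; last exact: (integrableB measurableT int1 intd).
rewrite (integralB measurableT int1 intd) damped_massE//.
rewrite [X in (_ * (X - _))%E](_ : _ = 1%E)//.
by rewrite integral_cst// mul1e; exact: probability_setT.

Qed.

Lemma damped_moment2_ge0 nu y : 0 < y -> 0 <= damped_moment2 nu y.
Proof.
move=> y0; rewrite -lee_fin -integral_sqr_damping//.
by apply: integral_ge0 => x _; rewrite lee_fin mulr_ge0 ?sqr_ge0 ?damping_ge0.
Qed.

Lemma moment2_lim nu :
  (damped_moment2 nu n.+1%:R)%:E @[n --> \oo] --> moment 2 nu.
Proof.
under eq_fun do rewrite -integral_sqr_damping//.
apply: monotone_damping => [|x]; last exact: sqr_ge0.
exact: exprn_measurable.
Qed.

Lemma integrable_sqr nu (m : R) : moment 2 nu = m%:E ->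
  nu.-integrable setT (EFin \o (fun x : R => x ^+ 2)).
Proof.
move=> m2; apply/integrableP; split.
  by apply/measurable_EFinP; exact: exprn_measurable.
under eq_integral do rewrite /= ger0_norm ?sqr_ge0//.
by rewrite -/(moment 2 nu) m2 ltry.
Qed.

Lemma integrable_sqr_damping nu y : 0 < y ->
  nu.-integrable setT (EFin \o (fun x : R => x ^+ 2 * damping y x)).
Proof.
move=> y0; apply/integrableP; split.
  apply/measurable_EFinP; apply: measurable_funM; first exact: exprn_measurable.
  exact: measurable_damping.
rewrite [X in (X < _)%E](_ : _ = (damped_moment2 nu y)%:E) ?ltry//.
rewrite -integral_sqr_damping//; apply: eq_integral => x _ /=.
by rewrite ger0_norm// mulr_ge0 ?sqr_ge0 ?damping_ge0.
Qed.

(** As x^2 - x^2 d = x^4 d / y^2 for the cutoff d, the rescaled defect of the truncated second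
    moment is a truncated fourth moment. The finite second moment allows the integral of the
    difference to be split. *)
Lemma moment4_lim nu (m : R) : moment 2 nu = m%:E ->
  (n.+1%:R ^+ 2 * (m - damped_moment2 nu n.+1%:R))%:E @[n --> \oo] -->
  moment 4 nu.
Proof.
move=> m2; have int2 := integrable_sqr m2.
have -> : (fun n => (n.+1%:R ^+ 2 * (m - damped_moment2 nu n.+1%:R))%:E) =
    (fun n => \int[nu]_x (x ^+ 4 * damping n.+1%:R x)%:E)%E.
  apply/funext => n; have y0 : 0 < n.+1%:R :> R by [].
  have intd := integrable_sqr_damping nu y0.
  transitivity (\int[nu]_x ((n.+1%:R ^+ 2)%:E *
    ((x ^+ 2)%:E - (x ^+ 2 * damping n.+1%:R x)%:E)))%E.
    rewrite integralZl//; last exact: (integrableB measurableT int2 intd).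
    rewrite (integralB measurableT int2 intd) integral_sqr_damping//.
    by rewrite -/(moment 2 nu) m2.
  apply: eq_integral => x _; rewrite -EFinB -EFinM; congr _%:E.
  rewrite -[4%N]/(2 + 2)%N exprD -mulrA [in RHS]sqr_mul_damping//; ring.
apply: (@monotone_damping _ nu (fun x => x ^+ 4)) => [|x].
  exact: exprn_measurable.
exact: exprn_even_ge0.
Qed.

(** With h the damped mass of [mu], the relation between K-transforms reads h_rho = h / (1 + (n - 1)
    (1 - h)), so 1 - h_rho = n (1 - h) / (1 + (n - 1) (1 - h)); it remains to multiply by y^2. *)
Lemma damped_moment2_pow mu n rho y : symmetric_prob mu ->
  is_boolean_pow mu n rho -> (0 < n)%N -> 0 < y ->
  0 < 1 + n.-1%:R * damped_moment2 mu y / y ^+ 2 /\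
  damped_moment2 rho y =
    n%:R * damped_moment2 mu y / (1 + n.-1%:R * damped_moment2 mu y / y ^+ 2).
Proof.
move=> sym pow n0 y0.
have [_] := K_transform_pow_imag sym pow y0.
have hmu := damped_mass_gt0 mu y0; have hrho := damped_mass_gt0 rho y0.
have hmu1 : damped_mass mu y <= 1.
  by have := damped_moment2_ge0 mu y0; rewrite pmulr_rge0 ?exprn_gt0// subr_ge0.
rewrite /damped_moment2.
rewrite -{1 3}(prednK n0); move: hmu hrho hmu1.
set a := damped_mass mu y; set b := damped_mass rho y; move=> a0 b0 a1.
have : 0 <= n.-1%:R :> R by [].
rewrite -natr1; set k := n.-1%:R => k0 /(congr1 (+%R^~ 1)).
rewrite subrK => /(congr1 GRing.inv); rewrite invrK => ->.
have -> : 1 + k * (y ^+ 2 * (1 - a)) / y ^+ 2 = 1 + k * (1 - a).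
  by field; rewrite gt_eqF.
have D : 0 < 1 + k * (1 - a) by rewrite ltr_wpDr// mulr_ge0// subr_ge0.
split=> //; field.
by rewrite !gt_eqF.
Qed.

Lemma boolean_pow_moments mu n rho (m4 : R) : symmetric_prob mu ->
  is_boolean_pow mu n rho -> (0 < n)%N ->
  moment 2 mu = 1%E -> moment 4 mu = m4%:E ->
  moment 2 rho = n%:R%:E /\ moment 4 rho = (n%:R * (m4 + n.-1%:R))%:E.
Proof.
move=> sym pow n0 mu2 mu4.
pose y (k : nat) : R := k.+1%:R; pose a k := damped_moment2 mu (y k).
(* [b] tends to m_4 by [moment4_lim], the second moment of [mu] being 1; [D] is the denominator in
   [damped_moment2_pow] and tends to 1. *)
pose b k := y k ^+ 2 * (1 - a k).
pose D k := 1 + n.-1%:R * a k / y k ^+ 2.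
have y0 k : 0 < y k by [].
have rhoE k : 0 < D k /\ damped_moment2 rho (y k) = n%:R * a k / D k.
  exact: damped_moment2_pow.
have a_lim : a k @[k --> \oo] --> (1 : R).
  by have := @moment2_lim mu; rewrite mu2 => /fine_cvgP[].
have b_lim : b k @[k --> \oo] --> m4.
  by have := @moment4_lim mu _ mu2; rewrite mu4 => /fine_cvgP[].
have yV_lim : (y k)^-1 @[k --> \oo] --> (0 : R) by exact: cvg_harmonic.
have D_lim : (D k)^-1 @[k --> \oo] --> (1 : R).
  rewrite -[X in _ --> X]invr1; apply: cvgV => //.
  have -> : 1 = 1 + n.-1%:R * 1 * (0 * 0) :> R by rewrite !mulr0 addr0.
  have -> : D = fun k => 1 + n.-1%:R * a k * ((y k)^-1 * (y k)^-1).
    by apply/funext => k; rewrite /D expr2 invfM.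
  apply: cvgD; first exact: cvg_cst.
  by apply: cvgM; [apply: cvgM; [exact: cvg_cst|]|exact: cvgM].
have rho2 : moment 2 rho = n%:R%:E.
  apply: (cvg_unique (@ereal_hausdorff R) (@moment2_lim rho)).
  have -> : (fun k => (damped_moment2 rho k.+1%:R)%:E) =
      (fun k => (n%:R * a k * (D k)^-1)%:E).
    by apply/funext => k; rewrite (rhoE k).2.
  suff : n%:R * a k * (D k)^-1 @[k --> \oo] --> (n%:R : R).
    by move=> ?; apply: cvg_EFin; first exact: nearW.
  rewrite -[X in _ --> X]mulr1; apply: cvgM => //.
  by rewrite -[X in _ --> X]mulr1; apply: cvgM => //; exact: cvg_cst.
split=> //.
(* [moment4_lim] takes the second moment of [rho] as input, which fixes the order of the two
   computations. *)
apply: (cvg_unique (@ereal_hausdorff R) (@moment4_lim rho _ rho2)).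
(* Here y^2 (n - n a / D) = n y^2 (D - a) / D, and y^2 (D - a) = b + (n - 1) a. *)
have -> : (fun k => (k.+1%:R ^+ 2 * (n%:R - damped_moment2 rho k.+1%:R))%:E) =
    (fun k => (n%:R * (b k + n.-1%:R * a k) * (D k)^-1)%:E).
  apply/funext => k; congr _%:E; have [D0] := rhoE k; rewrite /y => ->.
  move: D0; rewrite /b /D -/(y k); have := y0 k; move: (y k) (a k) => z c z0.
  have -> : n%:R = 1 + n.-1%:R :> R by rewrite nat1r prednK.
  move: (n.-1%:R) => m D0; field.
  rewrite (gt_eqF z0) /=.
  have -> : z ^+ 2 + m * c = z ^+ 2 * (1 + m * c / z ^+ 2).
    by field; rewrite gt_eqF.
  by rewrite mulf_neq0 ?expf_neq0 ?gt_eqF.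
suff : n%:R * (b k + n.-1%:R * a k) * (D k)^-1 @[k --> \oo] -->
    (n%:R * (m4 + n.-1%:R) : R).
  by move=> ?; apply: cvg_EFin; first exact: nearW.
rewrite -[X in _ --> X]mulr1; apply: cvgM => //.
apply: cvgM; first exact: cvg_cst.
apply: cvgD => //.
rewrite -[X in _ --> X]mulr1; apply: cvgM => //.
exact: cvg_cst.
Qed.
End moments.

(** * Equal mass of the two open half-lines *)

Section balance.
Context {R : realType}.
Implicit Types (nu rho : probR R) (t x y : R).
Notation leb := (@lebesgue_measure R).

(** The indicator turns an integral over y > 0 into one over the whole line. [t] is meant to be the
    positive or the negative part of x, so that the kernel is nonnegative and Tonelli applies. *)
Definition half_kernel t y : R := t / (t ^+ 2 + y ^+ 2) * \1_(`]0, +oo[) y.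

Lemma half_kernel_ge0 t y : 0 <= t -> 0 <= half_kernel t y.
Proof. by move=> t0; rewrite mulr_ge0// divr_ge0// addr_ge0 ?sqr_ge0. Qed.

Lemma half_kernelB x y : 0 < y ->
  half_kernel (Num.max x 0) y - half_kernel (Num.max (- x) 0) y =
  x / (x ^+ 2 + y ^+ 2).
Proof.
move=> y0; rewrite /half_kernel indicE mem_set/= ?in_itv/= ?y0// !mulr1.
have [x0|x0] := leP x 0.
  by rewrite max_l ?oppr_ge0// mul0r sub0r sqrrN mulNr opprK.
by rewrite max_r ?oppr_le0 1?ltW// mul0r subr0.
Qed.

(** For t > 0 an antiderivative is atan (y / t), which goes from 0 to pi / 2; for t = 0 the kernel
    is zero, whence the boolean factor. *)
Lemma integral_half_kernel t : 0 <= t ->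
  (\int[leb]_y (half_kernel t y)%:E)%E = (pi / 2 * (0 < t)%R%:R)%:E.
Proof.
rewrite le_eqVlt => /predU1P[<-|t0].
  rewrite ltxx mulr0 -[RHS](integral0 leb setT); apply: eq_integral => y _.
  by rewrite /half_kernel !mul0r.
rewrite t0 mulr1.
transitivity (\int[leb]_(y in `]0%R, +oo[) (t / (t ^+ 2 + y ^+ 2))%:E)%E.
  rewrite [RHS]integral_mkcond; apply: eq_integral => y _.
  rewrite /half_kernel patchE indicE.
  by case: (y \in _); rewrite ?mulr1 ?mulr0.
have cf : continuous (fun y => t / (t ^+ 2 + y ^+ 2)).
  move=> y; apply: cvgM; first exact: cvg_cst.
  apply: cvgV; first by rewrite addrC gt_eqF// sum_sqr_gt0.
  apply: cvgD; first exact: cvg_cst.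
  exact: exprn_continuous.
have dF y : is_derive y 1 (fun y => atan (y / t)) (t / (t ^+ 2 + y ^+ 2)).
  apply: is_derive_eq; rewrite scaler0 add0r /GRing.scale /=; field.
  by rewrite !gt_eqF// addrC sum_sqr_gt0.
(* The endpoint y = 0 is a null set; adding it gives the closed half-line on which the fundamental
   theorem of calculus is applied. *)
rewrite integral_itv_obnd_cbnd; last first.
  apply/measurable_EFinP; apply: measurable_funTS.
  exact: continuous_measurable_fun.
rewrite (@ge0_continuous_FTC2y _ _ (fun y => atan (y / t)) _ (pi / 2)).
- by rewrite mul0r atan0 sube0.
- by move=> y _; rewrite divr_ge0 ?ltW// addrC sum_sqr_gt0.
- exact: continuous_subspaceT.
- have h : y / t @[y --> +oo] --> +oo.
    by apply: gt0_cvgMly; [rewrite invr_gt0|exact: cvg_id].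
  exact: (cvg_comp _ _ h (@cvgy_atan R)).
- by move=> y _; exact: ex_derive.
- apply: cvg_at_right_filter.
  apply: differentiable_continuous; apply/derivable1_diffP.
  exact: ex_derive.
- by move=> y _; rewrite derive1E; exact: derive_val.
Qed.

Lemma measurable_half_kernel d (T : measurableType d) (f g : T -> R) :
  measurable_fun setT f -> measurable_fun setT g ->
  measurable_fun setT (fun p => half_kernel (f p) (g p)).
Proof.
move=> mf mg; apply: measurable_funM.
  by apply: measurable_funM => //; exact: measurable_sum_sqrV.
by apply: measurableT_comp => //; exact: measurable_indic.
Qed.

(** Tonelli: integrating over y first leaves pi / 2 times the indicator of the set where [g] is
    positive. *)
Lemma integral_half_kernel_fst nu (g : R -> R) : measurable_fun setT g ->
  (forall x, 0 <= g x) ->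
  (\int[leb]_y \int[nu]_x (half_kernel (g x) y)%:E =
   (pi / 2)%:E * nu [set x | (0 < g x)%R])%E.
Proof.
move=> mg g0; pose A := [set x : measurableTypeR R | 0 < g x].
have mA : measurable A.
  rewrite (_ : A = setT `&` g @^-1` `]0, +oo[); first exact: mg.
  by apply/seteqP; split=> x; rewrite /A /= in_itv/= andbT// => -[].
rewrite -(@fubini_tonelli _ _ _ _ _ nu leb
  (fun p => (half_kernel (g p.1) p.2)%:E)).
- have indA x :
    (\int[leb]_y (half_kernel (g x) y)%:E = (pi / 2)%:E * (\1_A x)%:E)%E.
    rewrite integral_half_kernel// -EFinM indicE /A; congr (_ * _%:R)%:E.
    by congr nat_of_bool; apply/idP/idP; rewrite inE.
  under eq_integral do rewrite /= indA.
  rewrite ge0_integralZl//.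
  + by rewrite integral_indic// setIT.
  + by apply/measurable_EFinP; exact: measurable_indic.
  + by rewrite lee_fin divr_ge0 ?pi_ge0.
- apply/measurable_EFinP; apply: measurable_half_kernel => //.
  exact: measurableT_comp.
- by move=> p; rewrite lee_fin half_kernel_ge0.
Qed.

(** The kernel of [conj_poisson] is the difference of the half kernels of the positive and negative
    parts of x. Its vanishing integral makes these two agree in mean for each y > 0, and integrating
    over y weighs the two half-lines. *)
Lemma balanced nu : (forall y, 0 < y -> conj_poisson nu y = 0) ->
  nu [set x | 0 < x] = nu [set x | x < 0].
Proof.
move=> nu0.
(* The values 1 and -1 of [s] treat both half-lines at once; 2 / pi cancels the constant of
   [integral_half_kernel_fst]. *)
have h (s : R) : s \in [:: 1; -1] -> nu [set x | 0 < s * x] =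
   ((2 / pi)%:E *
    \int[leb]_y \int[nu]_x (half_kernel (Num.max (s * x) 0) y)%:E)%E.
  move=> s1; rewrite integral_half_kernel_fst.
  - rewrite muleA -EFinM (_ : 2 / pi * _ = 1) ?mul1e; last first.
      by move: pi (pi_gt0 R) => p p0; field; rewrite gt_eqF.
    by congr (nu _); apply/seteqP; split=> x /=; rewrite lt_max ltxx orbF.
  - by apply: measurable_maxr => //; exact: measurable_funM.
  - by move=> x; rewrite le_max lexx orbT.
transitivity (nu [set x | 0 < 1 * x]).
  by congr (nu _); apply/seteqP; split=> x /=; rewrite mul1r.
transitivity (nu [set x | 0 < -1 * x]); last first.
  by congr (nu _); apply/seteqP; split=> x /=; rewrite mulN1r oppr_gt0.
rewrite !h ?inE ?eqxx ?orbT//; congr (_ * _)%E; apply: eq_integral => y _.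
have [y0|y0] := leP y 0.
  apply: eq_integral => x _; rewrite /half_kernel indicE memNset ?mulr0//=.
  by rewrite in_itv/= andbT; apply/negP; rewrite -leNgt.
have int (s : R) : s \in [:: 1; -1] ->
    nu.-integrable setT (EFin \o (fun x => half_kernel (Num.max (s * x) 0) y)).
  move=> s1; apply: (@integrable_bounded _ _ _ y^-1).
    apply: measurable_half_kernel => //.
    by apply: measurable_maxr => //; exact: measurable_funM.
  move=> x; rewrite /half_kernel indicE mem_set ?mulr1 ?conj_kernel_le//=.
  by rewrite in_itv/= y0.
have int1 := int 1; have intN1 := int (-1).
(* Both integrals are finite, so the equality can be proved in the reals, as a vanishing
   difference. *)
suff e : \int[nu]_x half_kernel (Num.max (1 * x) 0) y =
         \int[nu]_x half_kernel (Num.max (-1 * x) 0) y.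
  move: (congr1 EFin e); rewrite /Rintegral !fineK//.
  - by apply: integrable_fin_num => //; apply: intN1; rewrite !inE eqxx orbT.
  - by apply: integrable_fin_num => //; apply: int1; rewrite !inE eqxx.
apply/eqP; rewrite -subr_eq0 -RintegralB//; last 2 first.
- by apply: int1; rewrite !inE eqxx.
- by apply: intN1; rewrite !inE eqxx orbT.
apply/eqP; apply: etrans (nu0 y y0); apply: eq_Rintegral => x _.
by rewrite mul1r mulN1r half_kernelB.
Qed.
End balance.

(** * A coupling with the Rademacher law and its cost *)

Section wasserstein.
Context {R : realType}.
Implicit Types (nu : probR R).
Notation mR := (measurableTypeR R).

(* The product with a second Rademacher variable randomizes the sign at [0]. *)
Definition pos_event : set (mR * mR) :=
  ([set x | 0 < x] `*` setT) `|` ([set 0] `*` [set e | 0 < e]).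

Lemma measurable_gt0 : measurable ([set x | 0 < x] : set mR).
Proof.
rewrite (_ : [set x | _] = `]0%R, +oo[%classic); first exact: measurable_itv.
by apply/seteqP; split=> x /=; rewrite in_itv/= andbT.
Qed.

Lemma measurable_lt0 : measurable ([set x | x < 0] : set mR).
Proof.
rewrite (_ : [set x | _] = `]-oo, 0%R[%classic); first exact: measurable_itv.
by apply/seteqP; split=> x /=; rewrite in_itv.
Qed.

Lemma measurable_pos_event : measurable pos_event.
Proof.
apply: measurableU; apply: measurableX => //; first exact: measurable_gt0.
exact: measurable_gt0.
Qed.

Definition coupled_pair (p : mR * mR) : (mR * mR)%type :=
  (p.1, 2 * \1_pos_event p - 1).

Lemma measurable_coupled_pair : measurable_fun setT coupled_pair.
Proof.
apply: measurable_fun_pair; first exact: measurable_fst.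
apply: measurable_funB => //; apply: measurable_funM => //.
exact: measurable_indic measurable_pos_event.
Qed.

HB.instance Definition _ :=
  isMeasurableFun.Build _ _ _ _ coupled_pair measurable_coupled_pair.

Lemma rademacherE (B : set mR) :
  rademacher B = (2^-1 * (-1 \in B)%:R + 2^-1 * (1 \in B)%:R)%:E.
Proof. by rewrite /rademacher measure_addE /= /mscale /= !diracE -!EFinM. Qed.

(** If p is the common mass of the half-lines, then 2 p + nu {0} = 1, while the event has
    probability p + nu {0} / 2. *)
Lemma prob_pos_event nu : nu [set x | 0 < x] = nu [set x | x < 0] ->
  (nu \x @rademacher R)%E pos_event = (2^-1)%:E.
Proof.
move=> bal; have mgt0 := measurable_gt0; have mlt0 := measurable_lt0.
have rT : @rademacher R setT = 1%E by exact: probability_setT.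
have r0 : @rademacher R [set e | 0 < e] = (2^-1)%:E.
  rewrite rademacherE memNset ?mem_set//=; last first.
    by apply/negP; rewrite -leNgt oppr_le0.
  by rewrite mulr0 add0r mulr1.
transitivity (nu [set x | (0 < x)%R] * @rademacher R setT +
    nu [set 0%R] * @rademacher R [set e | (0 < e)%R])%E.
  rewrite /pos_event measureU; first congr (_ + _)%E.
  - exact: product_measure1E.
  - exact: product_measure1E.
  - exact: measurableX.
  - exact: measurableX.
  - apply/seteqP; split=> // -[x e] /= [[x0 _] [xE _]].
    by rewrite xE ltxx in x0.
rewrite rT r0 mule1.
have : (nu [set x | (0 < x)%R] + nu [set 0%R] + nu [set x | (x < 0)%R] = 1)%E.
  rewrite -(probability_setT nu) -measureU//; last first.
    by apply/seteqP; split=> // x /= [/[swap] ->]; rewrite ltxx.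
  rewrite -measureU//; last 2 first.
  - exact: measurableU.
  - apply/seteqP; split=> // x /= [[x0|x0]]; first by rewrite ltNge ltW.
    by rewrite x0 ltxx.
  congr (nu _); apply/seteqP; split=> // x _ /=.
  by have [x0|x0|x0] := ltgtP x 0; [right|left; left|left; right].
rewrite -bal -(@fineK _ (nu [set x | 0 < x])) ?fin_num_measure//.
rewrite -(@fineK _ (nu [set 0])) ?fin_num_measure//.
rewrite -EFinM -!EFinD => -[h]; congr _%:E; lra.
Qed.

Lemma coupling_pos nu : nu [set x | 0 < x] = nu [set x | x < 0] ->
  couplings nu (@rademacher R)
    (distribution (nu \x @rademacher R)%E coupled_pair).
Proof.
move=> bal; have mE := measurable_pos_event.
have PE := prob_pos_event bal.
have PEC : (nu \x @rademacher R)%E (~` pos_event) = (2^-1)%:E.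
  transitivity (1 - (nu \x @rademacher R)%E pos_event)%E.
    exact: probability_setC.
  by rewrite PE -EFinB; congr _%:E; lra.
split=> [A mA|B mB].
  transitivity ((nu \x @rademacher R)%E (A `*` setT)).
    apply: (congr1 (nu \x @rademacher R)%E).
    by apply/seteqP; split=> -[x e] //= [].
  rewrite -[RHS]mule1 -(probability_setT (@rademacher R)).
  exact: product_measure1E.
rewrite /distribution /pushforward.
have valE p : p \in pos_event -> 2 * \1_pos_event p - 1 = 1 :> R.
  by move=> pE; rewrite indicE pE mulr1; ring.
have valN p : p \notin pos_event -> 2 * \1_pos_event p - 1 = -1 :> R.
  by move=> pE; rewrite indicE (negbTE pE) mulr0 sub0r.
apply: etrans (esym (rademacherE B)).
(* According to which of the atoms 1 and -1 lie in [B], the preimage of [B] is the whole space,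
   [pos_event], its complement or empty. *)
have [B1|B1] := boolP (1 \in B); have [N1|N1] := boolP (-1 \in B);
  rewrite ?B1 ?N1 ?(negbTE B1) ?(negbTE N1) /= ?mulr1 ?mulr0 ?addr0 ?add0r.
- rewrite -[RHS](_ : (nu \x @rademacher R)%E setT = _); last first.
    rewrite probability_setT; congr _%:E; lra.
  apply: (congr1 (nu \x @rademacher R)%E); apply/seteqP; split=> // p _ /=.
  by have [/valE ->|/valN ->] := boolP (p \in pos_event); exact/set_mem.
- rewrite -PE; apply: (congr1 (nu \x @rademacher R)%E).
  apply/seteqP; split=> p /= pE.
    apply: contrapT => pN; move: pE; rewrite (valN _ (negbT (memNset pN))).
    by move=> /mem_set; rewrite (negbTE N1).
  by rewrite (valE _ (mem_set pE)); exact/set_mem.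
- rewrite -PEC; apply: (congr1 (nu \x @rademacher R)%E).
  apply/seteqP; split=> p /= pE.
    move=> pN; move: pE; rewrite (valE _ (mem_set pN)) => /mem_set.
    by rewrite (negbTE B1).
  by rewrite (valN _ (negbT (memNset pE))); exact/set_mem.
- rewrite -[RHS](measure0 (nu \x @rademacher R)%E).
  apply: (congr1 (nu \x @rademacher R)%E); apply/seteqP; split=> // p /=.
  have [/valE ->|/valN ->] := boolP (p \in pos_event) => /mem_set.
    by rewrite (negbTE B1).
  by rewrite (negbTE N1).
Qed.


(** On [pos_event] x >= 0 and off it x <= 0, so the left side is (|x| - 1)^2; the remaining factor
    (|x| + 1)^2 of (x^2 - 1)^2 is at least 1. *)
Lemma coupled_pair_dist (p : mR * mR) :
  `|(coupled_pair p).1 - (coupled_pair p).2| ^+ 2 <= (p.1 ^+ 2 - 1) ^+ 2.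
Proof.
rewrite real_normK ?num_real//; case: p => x e /=; rewrite indicE.
have [/set_mem pE|pN] := boolP ((x, e) \in pos_event).
  have x0 : 0 <= x by case: pE => /= -[]; [move/ltW|move->].
  have -> : (x ^+ 2 - 1) ^+ 2 = (x - 1) ^+ 2 * (x + 1) ^+ 2 by ring.
  have -> : x - (2 * 1 - 1) = x - 1 by ring.
  by rewrite ler_peMr ?sqr_ge0// exprn_ege1// lerDr.
have x0 : x <= 0.
  rewrite leNgt; apply: contra pN => x0; apply/mem_set; left.
  by split.
have -> : (x ^+ 2 - 1) ^+ 2 = (x + 1) ^+ 2 * (1 - x) ^+ 2 by ring.
have -> : x - (2 * 0 - 1) = x + 1 by ring.
by rewrite ler_peMr ?sqr_ge0// exprn_ege1// lerDl oppr_ge0.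
Qed.

Lemma W2_le_discrepancy nu : nu [set x | 0 < x] = nu [set x | x < 0] ->
  (W2 nu (@rademacher R) <= boolean_stein_discrepancy nu)%E.
Proof.
move=> bal; pose P : probability (mR * mR)%type R := (nu \x @rademacher R)%E.
have cpl := coupling_pos bal.
have mF : measurable_fun setT (fun x : mR => ((x ^+ 2 - 1) ^+ 2)%:E).
  apply/measurable_EFinP; apply: measurable_funX; exact: measurable_funB.
have mC : measurable_fun setT (fun p : mR * mR => (`|p.1 - p.2| ^+ 2)%:E).
  apply/measurable_EFinP; apply: measurable_funX; apply: measurableT_comp => //.
  exact: measurable_funB.
have : (W2 nu (@rademacher R) <=
    sqrte (\int[distribution P coupled_pair]_p (`|p.1 - p.2| ^+ 2)%:E))%E.
  by apply: ereal_inf_lbound; exists (distribution P coupled_pair).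
move=> /le_trans; apply.
rewrite /boolean_stein_discrepancy lee_sqrt; last first.
  by apply: integral_ge0 => x _; rewrite lee_fin sqr_ge0.
rewrite ge0_integral_distribution//.
have -> : (\int[nu]_x ((x ^+ 2 - 1) ^+ 2)%:E =
    \int[P]_p ((p.1 ^+ 2 - 1) ^+ 2)%:E)%E.
  (* The discrepancy is lifted to the product space to compare integrands pointwise. [coupled_pair]
     keeps the first coordinate, so the first marginal of the coupling is also that of [P]. *)
  transitivity (\int[pushforward P fst]_x ((x ^+ 2 - 1) ^+ 2)%:E)%E.
    apply: eq_measure_integral => A mA _; apply/esym.
    exact: cpl.1.
  rewrite ge0_integral_pushforward//.
  by move=> x _; rewrite lee_fin sqr_ge0.
apply: ge0_le_integral => //.
- by move=> p _; rewrite lee_fin sqr_ge0.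
- by apply: measurableT_comp => //; exact: measurable_coupled_pair.
- exact: (measurableT_comp mF measurable_fst).
- by move=> p _; rewrite lee_fin coupled_pair_dist.
Qed.
End wasserstein.

(** * Effect of a dilation on the discrepancy and on the balance of mass *)

Section dilation.
Context {R : realType}.
Implicit Types (mu nu rho : probR R).

Lemma integrable_pow4 nu (m : R) : moment 4 nu = m%:E ->
  nu.-integrable setT (EFin \o (fun x : R => x ^+ 4)).
Proof.
move=> m4; apply/integrableP; split.
  by apply/measurable_EFinP; exact: exprn_measurable.
under eq_integral do rewrite /= ger0_norm ?exprn_even_ge0//.
by rewrite -/(moment 4 nu) m4 ltry.
Qed.

Lemma boolean_stein_discrepancy_dilation nu (c m2 m4 : R) :
  moment 2 nu = m2%:E -> moment 4 nu = m4%:E ->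
  boolean_stein_discrepancy (dilation c nu) =
  (Num.sqrt (c ^+ 4 * m4 - 2 * c ^+ 2 * m2 + 1))%:E.
Proof.
move=> M2 M4; rewrite /boolean_stein_discrepancy /dilation.
have i2 := integrable_sqr M2; have i4 := integrable_pow4 M4.
rewrite ge0_integral_distribution; last 2 first.
- by apply/measurable_EFinP; apply: measurable_funX; exact: measurable_funB.
- by move=> x; rewrite lee_fin sqr_ge0.
have i4' : nu.-integrable setT (fun x => (c ^+ 4)%:E * (x ^+ 4)%:E)%E.
  exact: integrableZl.
have i2' : nu.-integrable setT (fun x => (- (2 * c ^+ 2))%:E * (x ^+ 2)%:E)%E.
  exact: integrableZl.
have i1 : nu.-integrable setT (cst (1 : R)%:E).
  exact: finite_measure_integrable_cst.
have -> : (\int[nu]_x ((fun x => ((x ^+ 2 - 1) ^+ 2)%:E) \o scale_fun c) x =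
  \int[nu]_x ((c ^+ 4)%:E * (x ^+ 4)%:E +
    ((- (2 * c ^+ 2))%:E * (x ^+ 2)%:E + cst 1%:E x)))%E.
  apply: eq_integral => x _; rewrite /= -!EFinM -!EFinD /scale_fun; congr _%:E.
  ring.
rewrite integralD//; last exact: integrableD.
rewrite integralD// !integralZl//.
rewrite -/(moment 4 nu) -/(moment 2 nu) M2 M4 integral_cst// mul1e.
rewrite [X in (_ + (_ + X))%E](_ : _ = 1%E); last exact: probability_setT.
rewrite -!EFinM -!EFinD /=; congr (Num.sqrt _)%:E; ring.
Qed.

Lemma balanced_dilation nu (c : R) : 0 < c ->
  nu [set x | 0 < x] = nu [set x | x < 0] ->
  dilation c nu [set x | 0 < x] = dilation c nu [set x | x < 0].
Proof.
move=> c0 bal.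
transitivity (nu [set x | 0 < x]).
  by apply: (congr1 nu); apply/seteqP; split=> x /=;
    rewrite /scale_fun pmulr_rgt0.
rewrite bal.
by apply: (congr1 nu); apply/seteqP; split=> x /=;
  rewrite /scale_fun pmulr_rlt0.
Qed.
End dilation.

Theorem proposition3p8 (R : realType) (mu : probability (measurableTypeR R) R) :
  symmetric_prob mu ->
  moment 1 mu = 0%E ->
  moment 2 mu = 1%E ->
  (moment 4 mu < +oo)%E ->
  forall n : nat, (1 <= n)%N ->
  forall mu_pow_n : probability (measurableTypeR R) R,
    is_boolean_pow mu n mu_pow_n ->
    let mu_n := dilation (1 / Num.sqrt n%:R) mu_pow_n in
    (W2 mu_n (@rademacher R) <= boolean_stein_discrepancy mu_n)%E /\
    boolean_stein_discrepancy mu_n =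
      (1 / Num.sqrt n%:R * Num.sqrt (fine (moment 4 mu) - 1))%:E.
Proof.
move=> sym _ mu2 mu4 n n0 rho pow mu_n.
have n0R : 0 < n%:R :> R by rewrite ltr0n.
(* As x^4 is nonnegative, the bound by +oo already makes this moment a real number. *)
have mu4E : moment 4 mu = (fine (moment 4 mu))%:E.
  rewrite fineK// ge0_fin_numE//.
  by apply: integral_ge0 => x _; rewrite lee_fin exprn_even_ge0.
have [rho2 rho4] := boolean_pow_moments sym pow n0 mu2 mu4E.
split.
  apply: W2_le_discrepancy; apply: balanced_dilation.
    by rewrite divr_gt0// sqrtr_gt0.
  by apply: balanced => y y0; have [] := K_transform_pow_imag sym pow y0.
rewrite (boolean_stein_discrepancy_dilation _ rho2 rho4); congr _%:E.
have -> : 1 / Num.sqrt n%:R = Num.sqrt (n%:R^-1) :> R by rewrite div1r sqrtrV.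
rewrite -sqrtrM ?invr_ge0 ?ler0n//; congr Num.sqrt.
have -> : Num.sqrt n%:R^-1 ^+ 4 = (n%:R^-1) ^+ 2 :> R.
  by rewrite (exprM _ 2 2) sqr_sqrtr// invr_ge0.
rewrite sqr_sqrtr ?invr_ge0//.
have -> : n.-1%:R = n%:R - 1 :> R by rewrite -{2}(prednK n0) -natr1 addrK.
(* With c^2 = 1 / n the radicand is (m_4 + n - 1) / n - 2 + 1 = (m_4 - 1) / n. *)
by field; rewrite gt_eqF.
Qed.
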